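(* Let $f(x)\in\mathbb{Z}[x]$ be a nonzero polynomial such that every irreducible factor of $f(x)$ (over $\mathbb{Q}$) has degree at most two. Then $f(\pi(\boldsymbol p))\neq0$ in $\mathcal{A}$, where $\pi(\boldsymbol{p})\coloneqq(\pi(p)\bmod p)_p$.
   Context: $\pi(X)$ is the prime counting function. $\mathcal{A}\coloneqq\bigl(\prod_{p}\mathbb{Z}/p\mathbb{Z}\bigr)/\bigl(\bigoplus_{p}\mathbb{Z}/p\mathbb{Z}\bigr)$ over all primes $p$; elements are written $(a_p)_p$ and are equal iff components agree for all but finitely many primes. Thus $f(\pi(\boldsymbol p))=0$ means $f(\pi(p))\equiv0\pmod p$ for all but finitely many primes $p$. *)

(* Defs.v *)
From HB Require Import structures.
From mathcomp Require Import all_boot all_order all_algebra.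
From mathcomp Require Import ring_quotient.
From mathcomp Require Import boolp classical_sets functions cardinality.

Set Implicit Arguments.
Unset Strict Implicit.
Unset Printing Implicit Defensive.

Import Order.TTheory GRing.Theory Num.Theory.
Local Open Scope ring_scope.
Local Open Scope quotient_scope.

Definition primepi (n : nat) : nat := count prime (iota 1 n).

Definition primeT : Type := {p : nat | prime p}.
HB.instance Definition _ := Countable.on primeT.

(* 'F_p is the ring of integers mod p, because val p is prime. *)
Definition prodFp : Type := forall p : primeT, 'F_(val p).

Section ProdRing.
Implicit Types a b c : prodFp.

HB.instance Definition _ := gen_eqMixin prodFp.
HB.instance Definition _ := gen_choiceMixin prodFp.

Definition prodFp_zero : prodFp := fun=> 0.
Definition prodFp_one : prodFp := fun=> 1.
Definition prodFp_opp a : prodFp := fun p => - a p.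
Definition prodFp_add a b : prodFp := fun p => a p + b p.
Definition prodFp_mul a b : prodFp := fun p => a p * b p.

Fact prodFp_addA : associative prodFp_add.
Proof. by move=> a b c; apply: functional_extensionality_dep => p; apply: addrA. Qed.
Fact prodFp_addC : commutative prodFp_add.
Proof. by move=> a b; apply: functional_extensionality_dep => p; apply: addrC. Qed.
Fact prodFp_add0 : left_id prodFp_zero prodFp_add.
Proof. by move=> a; apply: functional_extensionality_dep => p; apply: add0r. Qed.
Fact prodFp_addN : left_inverse prodFp_zero prodFp_opp prodFp_add.
Proof. by move=> a; apply: functional_extensionality_dep => p; apply: addNr. Qed.

HB.instance Definition _ :=
  GRing.isZmodule.Build prodFp prodFp_addA prodFp_addC prodFp_add0 prodFp_addN.

Fact prodFp_mulA : associative prodFp_mul.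
Proof. by move=> a b c; apply: functional_extensionality_dep => p; apply: mulrA. Qed.
Fact prodFp_mulC : commutative prodFp_mul.
Proof. by move=> a b; apply: functional_extensionality_dep => p; apply: mulrC. Qed.
Fact prodFp_mul1 : left_id prodFp_one prodFp_mul.
Proof. by move=> a; apply: functional_extensionality_dep => p; apply: mul1r. Qed.
Fact prodFp_mulD : left_distributive prodFp_mul prodFp_add.
Proof. by move=> a b c; apply: functional_extensionality_dep => p; apply: mulrDl. Qed.
Fact prodFp_one_neq0 : prodFp_one != 0.
Proof.
apply/eqP => /(congr1 (fun a : prodFp => a (exist _ 2%N isT))) /eqP.
by rewrite /prodFp_one oner_eq0.
Qed.

HB.instance Definition _ := GRing.Zmodule_isComNzRing.Build prodFp
  prodFp_mulA prodFp_mulC prodFp_mul1 prodFp_mulD prodFp_one_neq0.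

End ProdRing.

(* (+)_p Z/pZ embedded in \prod_p Z/pZ as the families of finite support. *)
Definition sumFp : pred prodFp :=
  fun a => `[< finite_set [set p : primeT | a p != 0] >].

Fact infinite_primeT : ~ finite_set [set: primeT].
Proof.
move=> finT.
have /finite_seqP [s sE] := finite_image (fun p : primeT => val p) finT.
have [q qs prq] := prime_above (\max_(i <- s) i).
suff : q \in s.
  by move=> qins; move: qs; rewrite ltnNge (@leq_bigmax_seq _ s xpredT id q).
suff : ([set` s] q)%classic by [].
by rewrite -sE; exists (exist _ q prq).
Qed.

Fact sumFp_idealr : idealr_closed sumFp.
Proof.
split.
- by apply/asboolP; apply: sub_finite_set (finite_set0 _) => p /= /eqP[].
- apply/negP => /asboolP fin1; apply: infinite_primeT.
  by apply: sub_finite_set fin1 => p _; apply: (oner_neq0 'F_(val p)).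
move=> c a b /asboolP fina /asboolP finb; apply/asboolP.
have finab : finite_set ([set p | a p != 0] `|` [set p | b p != 0])%classic.
  by rewrite finite_setU.
apply: sub_finite_set finab => p /=; have [a0|an0 _] := eqVneq (a p) 0; last by left.
have [b0|bn0 _] := eqVneq (b p) 0; last by right.
have -> : (c * a + b) p = c p * a p + b p by [].
by rewrite a0 b0 mulr0 addr0 eqxx.
Qed.

HB.instance Definition _ := isIdealr.Build prodFp sumFp sumFp_idealr.

Definition sumFp_ideal : idealr prodFp := sumFp.

Definition calA : comNzRingType := {ideal_quot sumFp_ideal}.

Definition toA (a : prodFp) : calA := \pi_{ideal_quot sumFp_ideal} a.

Lemma toA_eq (a b : prodFp) :
  toA a = toA b <-> finite_set [set p : primeT | a p != b p].
Proof.
have -> : [set p : primeT | a p != b p]%classic =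
          [set p : primeT | (a - b) p != 0]%classic.
  apply/seteqP; split=> p /=; rewrite -[(a - b) p]/(a p - b p);
  by rewrite subr_eq0.
rewrite /toA; split=> [/eqP|fin].
  by rewrite -Quotient.idealrBE => /asboolP.
by apply/eqP; rewrite -Quotient.idealrBE; apply/asboolP.
Qed.

Definition primepi_A : calA := toA (fun p => (primepi (val p))%:R).

(* Main.v *)
(* Let [p_n] be the [n]-th prime. If [f (n) = 0 mod p_n] for all large [n], then for all large [n] some irreducible factor of [f] vanishes at [n] modulo [p_n]; it is quadratic, since the value of a linear factor is nonzero and smaller than [p_n]. Multiplying by constants, [p_n m_n = a n^2 + b_n n + c_n] with a common [a > 0] and bounded integers [b_n], [c_n]. Fix a large [k]. If [p_(n+k) - p_n] were less than [(7/4) k p_n / n], then comparing both equations and using [n = o(p_n)] would force [m_(n+k) = m_n], hence [(p_(n+k) - p_n) m_n = 2 a k n + (b_(n+k) - b_n) n + O(1)], so that the gap is close to [2 k p_n / n], a contradiction. Thus [p_(n+k) - p_n >= (7/4) k p_n / n] for all large [n], which makes [p_n^2 / n^3] nondecreasing along multiples of [k]; but Chebyshev's lower bound for [pi] implies [p_n^2 = o(n^3)]. *)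

From HB Require Import structures.
Require Import Defs.
From mathcomp Require Import all_boot all_order all_algebra.
From mathcomp Require Import ring_quotient boolp classical_sets cardinality.
From mathcomp Require Import zify ring.

Set Implicit Arguments.
Unset Strict Implicit.

(** * Chebyshev's bounds *)

Lemma primepiS n : primepi n.+1 = primepi n + prime n.+1.
Proof. by rewrite /primepi -[in LHS](addn1 n) iotaD count_cat /= addn0. Qed.

Lemma leq_primepi m n : m <= n -> primepi m <= primepi n.
Proof.
by move=> /subnK <-; elim: (n - m) => // d IHd; rewrite addSn primepiS; lia.
Qed.

Lemma primepi_prime_ltn p q : prime q -> p < q -> primepi p < primepi q.
Proof.
case: q => // q q_pr lt_pq; rewrite primepiS q_pr addn1 ltnS.
exact: leq_primepi.
Qed.

Lemma primepi_unbounded n : exists m, n <= primepi m.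
Proof.
elim: n => [|n [m le_nm]]; first by exists 0.
have [q lt_mq q_pr] := prime_above m; exists q.
exact: leq_ltn_trans le_nm (primepi_prime_ltn q_pr lt_mq).
Qed.

(** The least [m] with [n <= primepi m] is prime because [primepi] jumps there, and the value is
    exactly [n] because the jump is by one. *)
Lemma nth_prime_exists n : 0 < n -> exists2 p, prime p & primepi p = n.
Proof.
move=> n_gt0; case: (ex_minnP (primepi_unbounded n)) => [[|p]];
  first by rewrite leqNgt n_gt0.
rewrite primepiS => le_n min_p; exists p.+1.
  by case: (prime p.+1) le_n => //; rewrite addn0 => /min_p; rewrite ltnn.
have lt_pi : primepi p < n by rewrite ltnNge; apply/negP => /min_p; rewrite ltnn.
by have := leq_b1 (prime p.+1); rewrite primepiS; lia.
Qed.

Lemma leq_bin_exp2 n m : 'C(n, m) <= 2 ^ n.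
Proof.
elim: n m => [|n IHn] [|m] //; first by rewrite bin0 expn_gt0.
by rewrite binS expnS mul2n -addnn leq_add.
Qed.

Lemma leq_exp2_central_bin n : 2 ^ n <= 'C(n.*2, n).
Proof.
elim: n => // n IHn.
have bin_sym : 'C(n.*2.+1, n.+1) = 'C(n.*2.+1, n).
  by rewrite -[in RHS]bin_sub; [congr 'C(_, _)|]; lia.
rewrite doubleS expnS binS -bin_sym binS; lia.
Qed.

Lemma sum_leq_nat t N : \sum_(1 <= k < N) (k <= t) <= t.
Proof.
case: N => [|N]; first by rewrite big_geq.
have [le_tN|lt_Nt] := leqP t N.
  have tail0 : \sum_(t.+1 <= k < N.+1) (k <= t) = 0.
    by rewrite big_nat big1 // => k /andP[lt_tk _]; rewrite leqNgt lt_tk.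
  rewrite (big_cat_nat (n := t.+1)) //= tail0 addn0.
  apply: (@leq_trans (\sum_(1 <= k < t.+1) 1)).
    by apply: leq_sum => k _; case: (k <= t).
  by rewrite sum_nat_const_nat; lia.
apply: (@leq_trans (\sum_(1 <= k < N.+1) 1)).
  by apply: leq_sum => k _; case: (k <= t).
by rewrite sum_nat_const_nat; lia.
Qed.

(** Terms with [k > n] vanish. A common range lets the Legendre sums of [n!] and [(2n)!] be compared
    termwise. *)
Lemma logn_fact_widen p n N : prime p -> n <= N ->
  logn p n`! = \sum_(1 <= k < N.+1) n %/ p ^ k.
Proof.
move=> p_pr le_nN; rewrite logn_fact //.
have tail0 : \sum_(n.+1 <= k < N.+1) n %/ p ^ k = 0.
  rewrite big_nat big1 // => k /andP[lt_nk _].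
  by rewrite divn_small // (leq_trans lt_nk) // ltnW // ltn_expl // prime_gt1.
by rewrite [RHS](big_cat_nat (n := n.+1)) //= tail0 addn0.
Qed.

(* Legendre's formula: each [k] contributes [2n %/ p^k - 2 (n %/ p^k)], which is at most 1, and only if [p^k <= 2n]. *)
Lemma leq_pfactor_central_bin p n : prime p -> 0 < n ->
  p ^ logn p 'C(n.*2, n) <= n.*2.
Proof.
move=> p_pr n_gt0; have p_gt1 := prime_gt1 p_pr.
apply: leq_trans (trunc_logP p_gt1 (n := n.*2) _); last by lia.
rewrite leq_exp2l //.
have := congr1 (logn p) (bin_fact (n := n.*2) (m := n) ltac:(lia)).
have -> : n.*2 - n = n by lia.
rewrite !lognM ?muln_gt0 ?fact_gt0 ?bin_gt0 //; last by lia.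
rewrite !(@logn_fact_widen p _ n.*2) //; last by lia.
set s1 := \sum_(_ <= _ < _) _; set s2 := \sum_(_ <= _ < _) _ => logE.
suff: s2 <= s1 + s1 + trunc_log p n.*2 by lia.
rewrite -big_split /=; apply: leq_trans (leq_add (leqnn _) (sum_leq_nat _ n.*2.+1)).
rewrite -big_split /=; apply: leq_sum => k _.
have pk_gt0 : 0 < p ^ k by rewrite expn_gt0 ltnW.
have [le_pk|lt_pk] := leqP (p ^ k) n.*2.
  rewrite (trunc_log_max p_gt1 le_pk) addn1 -ltnS ltn_divLR //.
  have := ltn_ceil n pk_gt0; nia.
by rewrite divn_small.
Qed.

(** Each prime power in the factorization of the binomial is at most [2n], so its primes are among
    the [primepi n.*2] primes up to [2n]. *)
Lemma leq_central_bin_exp_primepi n : 0 < n ->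
  'C(n.*2, n) <= n.*2 ^ primepi n.*2.
Proof.
move=> n_gt0; have bin_pos : 0 < 'C(n.*2, n) by rewrite bin_gt0; lia.
rewrite [X in X <= _]prod_prime_decomp // prime_decompE big_map /=.
apply: (@leq_trans (n.*2 ^ size (primes 'C(n.*2, n)))).
  rewrite -sum1_size expn_sum.
  rewrite big_seq [leqRHS]big_seq; apply: leq_prod => p.
  rewrite mem_primes => /andP[p_pr _]; rewrite expn1.
  exact: leq_pfactor_central_bin.
rewrite leq_exp2l /primepi -?size_filter; last by lia.
apply: uniq_leq_size (primes_uniq _) _ => p.
rewrite mem_filter mem_iota mem_primes => /and3P[p_pr _ p_dvd]; rewrite p_pr.
rewrite prime_gt0 //= add1n ltnS.
apply: leq_trans (leq_pfactor_central_bin p_pr n_gt0).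
by rewrite -{1}[p]expn1 leq_exp2l ?prime_gt1 // logn_gt0 mem_primes p_pr bin_pos.
Qed.

Lemma dvdn_prod_primes (s : seq nat) m : uniq s -> all prime s ->
  all (fun p => p %| m) s -> \prod_(p <- s) p %| m.
Proof.
elim: s => [|p s IHs] /=; first by rewrite big_nil dvd1n.
move=> /andP[ps s_uniq] /andP[p_pr s_pr] /andP[p_dvd s_dvd]; rewrite big_cons.
rewrite Gauss_dvd ?p_dvd ?IHs // prime_coprime // Euclid_dvd_prod //.
rewrite big_has; apply: contra ps => /hasP[q qs].
by rewrite dvdn_prime2 ?(allP s_pr q) // => /eqP->.
Qed.

(** Every prime in [(n, 2n]] divides [(2n)!] but not [n!], so the product of these primes, each
    larger than [n], divides the central binomial coefficient. *)
Lemma leq_exp_primepi_block n : 0 < n ->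
  n ^ (primepi n.*2 - primepi n) <= 2 ^ n.*2.
Proof.
move=> n_gt0; apply: leq_trans (leq_bin_exp2 _ n).
have -> : primepi n.*2 - primepi n = size (filter prime (iota n.+1 n)).
  by rewrite /primepi -addnn iotaD count_cat addKn size_filter.
set s := filter _ _.
have bin_pos : 0 < 'C(n.*2, n) by rewrite bin_gt0; lia.
apply: (@leq_trans (\prod_(p <- s) p)).
  rewrite -sum1_size expn_sum big_seq [leqRHS]big_seq.
  by apply: leq_prod => p; rewrite mem_filter mem_iota expn1; lia.
apply: dvdn_leq => //; apply: dvdn_prod_primes; rewrite ?filter_uniq ?iota_uniq ?filter_all //.
apply/allP => p; rewrite mem_filter mem_iota => /andP[p_pr p_bnd].
have: p %| n.*2`! by rewrite dvdn_fact //; lia.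
rewrite -(bin_fact (n := n.*2) (m := n)); last by lia.
have -> : n.*2 - n = n by lia.
rewrite !Euclid_dvdM // orbb => /orP[//|].
rewrite /= fact_prod Euclid_dvd_prod // big_has => /hasP[i].
by rewrite mem_index_iota => i_bnd /dvdn_leq; lia.
Qed.

Lemma primepi_leq_id n : primepi n <= n.
Proof. by rewrite /primepi -[leqRHS](size_iota 1 n) count_size. Qed.

(** Dyadic summation: for [i >= S], [S] times the number of primes between [2^i] and [2^(i+1)] is at
    most [2^(i+1)], and these bounds add up geometrically. Below [2^S] the trivial bound is used. *)
Lemma leq_primepi_exp2 S s :
  S * primepi (2 ^ (S + s)) <= S * 2 ^ S + 2 ^ (S + s).+1.
Proof.
elim: s => [|s IHs].
  by rewrite addn0 (leq_trans _ (leq_addr _ _)) // leq_mul2l primepi_leq_id orbT.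
have pow_gt0 : 0 < 2 ^ (S + s) by rewrite expn_gt0.
have := leq_exp_primepi_block pow_gt0.
rewrite -expnM leq_exp2l // -mul2n -expnS.
have := leq_primepi (m := 2 ^ (S + s)) (n := 2 ^ (S + s).+1) ltac:(by rewrite leq_exp2l).
rewrite !addnS [in X in _ -> _ -> _ <= _ + X]expnS; nia.
Qed.

Lemma primepi_little_o C : exists X, forall x, X <= x -> C * primepi x < x.
Proof.
(* With [2 ^ t <= x < 2 ^ t.+1], the dyadic bound gives [S * primepi x <= S * 2 ^ S + 4 * 2 ^ t < 5
   * x], so the factor 8 is enough. *)
have [S SE] : exists S, S = 8 * C.+1 by eexists.
exists (S * 2 ^ S).+1 => x le_Xx.
have [S_gt0 x_gt0] : 0 < S /\ 0 < x by lia.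
have /andP[le_tx lt_xt] := trunc_log_bounds (p := 2) isT x_gt0.
set t := trunc_log 2 x in le_tx lt_xt.
have le_St : S <= t.
  apply: trunc_log_max => //; exact: leq_trans (leq_pmull _ S_gt0) (ltnW le_Xx).
have := leq_primepi_exp2 S (t.+1 - S); rewrite subnKC; last by lia.
have : C * primepi x <= C.+1 * primepi (2 ^ t.+1).
  exact: leq_mul (leqnSn C) (leq_primepi (ltnW lt_xt)).
set P := primepi _; rewrite !expnS => le_CP le_SP.
have SPE : S * P = 8 * (C.+1 * P) by rewrite SE mulnA.
by move: (S * P) (C.+1 * P) (S * 2 ^ S) (2 ^ t) SPE le_CP le_SP le_Xx le_tx; lia.
Qed.

(** With [h = x./2], both bounds on ['C(2h, h)] give [2^h <= (2h)^(primepi (2h))], and [2h] is at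
    most a power of 2. The factor 3 absorbs the rounding in [x <= 2h + 1]. *)
Lemma leq_log_primepi x : 1 < x -> x <= 3 * (trunc_log 2 x).+1 * primepi x.
Proof.
move=> x_gt1; set t := (trunc_log 2 x).+1.
have half_gt0 : 0 < x./2 by lia.
have le_double : x./2.*2 <= x by lia.
have le_pow : x./2.*2 <= 2 ^ t.
  exact: leq_trans le_double (ltnW (trunc_log_ltn (p := 2) x isT)).
have pi_gt0 : 0 < primepi x./2.*2 by apply: (@leq_primepi 2); lia.
have le_pi := leq_primepi le_double.
suff: 2 ^ x./2 <= 2 ^ (t * primepi x./2.*2) by rewrite leq_exp2l //; nia.
apply: leq_trans (leq_exp2_central_bin _) _.
apply: leq_trans (leq_central_bin_exp_primepi half_gt0) _.
by rewrite expnM leq_exp2r.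
Qed.

Lemma leq_quartic_exp2 t : t ^ 4 <= 256 * 2 ^ t.
Proof.
have lt_u := ltn_expl (t %/ 4) (m := 2) isT.
have le_t : t <= 4 * 2 ^ (t %/ 4).
  by have := divn_eq t 4; have := ltn_pmod t (d := 4) isT; lia.
have: t ^ 4 <= (4 * 2 ^ (t %/ 4)) ^ 4 by rewrite leq_exp2r.
move=> /leq_trans; apply; rewrite expnMn -expnM leq_mul // leq_exp2l //.
exact: leq_trunc_div.
Qed.

(** Cubing the logarithmic bound leaves a loss of [27 * t.+1 ^ 3] with [t = trunc_log 2 x]; even
    multiplied by [M], this is below [x] for large [x]. *)
Lemma primepi_cube_lower M : exists X, forall x, X <= x -> M * x ^ 2 < primepi x ^ 3.
Proof.
(* The constant collects 27 from the cube, 256 from [leq_quartic_exp2], and 2 from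
   [2 ^ t.+1 = 2 * 2 ^ t]. *)
exists (2 ^ (54 * 256 * M).+1) => x le_Xx.
have x_gt1 : 1 < x by apply: leq_trans le_Xx; rewrite (@leq_exp2l 2 1).
have le_log := leq_log_primepi x_gt1.
have t_big : (54 * 256 * M).+1 <= trunc_log 2 x by apply: trunc_log_max.
have := trunc_logP (p := 2) isT (ltnW x_gt1).
move: le_log t_big; set t := trunc_log 2 x => le_log t_big pow_x.
move: (leq_quartic_exp2 t.+1); rewrite [2 ^ _]expnS => t4.
have T3 : 27 * M * t.+1 ^ 3 < x.
  have T3_gt0 : 0 < t.+1 ^ 3 by rewrite expn_gt0.
  have T4E : t.+1 ^ 4 = t.+1 * t.+1 ^ 3 by rewrite -expnS.
  have : 54 * 256 * M * t.+1 ^ 3 < t.+1 * t.+1 ^ 3 by rewrite ltn_pmul2r // ltnW.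
  rewrite -T4E => /leq_trans /(_ t4) {T4E t4}; rewrite -!mulnA.
  by move: (t.+1 ^ 3) (2 ^ t) pow_x => c d; lia.
have: x ^ 3 <= (3 * t.+1 * primepi x) ^ 3 by rewrite leq_exp2r.
rewrite !expnMn => x3.
rewrite -(ltn_pmul2l (m := 27 * t.+1 ^ 3)); last by rewrite muln_gt0 expn_gt0.
apply: leq_trans x3; rewrite [x ^ 3]expnS.
have -> : 27 * t.+1 ^ 3 * (M * x ^ 2) = 27 * M * t.+1 ^ 3 * x ^ 2 by lia.
by rewrite ltn_pmul2r // expn_gt0 ltnW.
Qed.

Import Order.TTheory GRing.Theory Num.Theory.
Local Open Scope ring_scope.

(** * Gaps between primes dividing quadratic values *)

(** Here [p] and [q] play the primes of index [n] and [n + k]. In the lower bound on [p], the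
    summand [7 * k * (a + 2 * B)] controls [4 * (q - p) * m] when the gap is short, which excludes
    [m' < m]; the other summands bound [q * m' - p * m], which excludes [m < m']. *)
Lemma quad_gap (a B n k p q m m' b c b' c' : int) :
    1 <= a -> 0 <= B -> k = 16 * (B + 1) ->
    8 * k * (B + 1) <= n ->
    (7 * k * (a + 2 * B) + a * k ^+ 2 + 2 * a * k + 4 * B + B * k) * n < p ->
    p < q -> `|b| <= B -> `|c| <= B -> `|b'| <= B -> `|c'| <= B ->
    p * m = a * n ^+ 2 + b * n + c ->
    q * m' = a * (n + k) ^+ 2 + b' * (n + k) + c' ->
  7 * k * p <= 4 * n * (q - p).
Proof.
move=> a1 B0 kE n_big p_big lt_pq.
rewrite !ler_norml => /andP[b1 b2] /andP[c1 c2] /andP[b3 b4] /andP[c3 c4] gE gE'.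
rewrite leNgt; apply/negP => gap.
have k16 : 16 <= k by lia.
have kB : 16 * B <= k by lia.
have k_gt0 : 0 < k by lia.
have kB0 : 0 <= k * B by rewrite mulr_ge0 // ltW.
have nk : 8 * k <= n by lia.
have nn : n * (8 * k * (B + 1)) <= n ^+ 2 by rewrite expr2 ler_pM2l //; lia.
have n_gt0 : 0 < n by lia.
have bn1 : - (B * n) <= b * n by rewrite -mulNr ler_pM2r.
have bn2 : b * n <= B * n by rewrite ler_pM2r.
have b'n1 : - (B * n) <= b' * n by rewrite -mulNr ler_pM2r.
have b'n2 : b' * n <= B * n by rewrite ler_pM2r.
have Bn0 : 0 <= B * n by rewrite mulr_ge0 // ltW.
have BnB : B <= B * n by rewrite ler_peMr //; lia.
have knB : 8 * k * (n * B) + 8 * k * n <= n ^+ 2 by lia.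
have an2 : n ^+ 2 <= a * n ^+ 2 by rewrite ler_peMl // sqr_ge0.
have ng : n * B <= n * (n * B) by rewrite ler_peMl //; lia.
set g := a * n ^+ 2 + b * n + c in gE.
have n16 : 16 * (n * B) <= k * (n * B) by rewrite ler_wpM2r //; lia.
have kn : 16 * n <= k * n by rewrite ler_pM2r.
have g_gt0 : 0 < g by rewrite /g; lia.
have g_le : g <= (a + 2 * B) * n ^+ 2 by rewrite /g; lia.
have p_gt0 : 0 < p.
  by apply: le_lt_trans p_big; rewrite !(mulr_ge0, addr_ge0, sqr_ge0) //; lia.
have m_gt0 : 0 < m by rewrite -(pmulr_rgt0 _ p_gt0) gE.
have hm : 4 * (q - p) * m < 7 * k * ((a + 2 * B) * n).
  rewrite -(ltr_pM2l n_gt0).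
  have : (4 * n * (q - p)) * m < (7 * k * p) * m by rewrite ltr_pM2r.
  rewrite -(mulrA _ p) gE.
  have : 7 * k * g <= 7 * k * ((a + 2 * B) * n ^+ 2) by rewrite ler_pM2l //; lia.
  by move=> le1 lt2; have := lt_le_trans lt2 le1; rewrite expr2; lia.
set D := q * m' - p * m.
have DE : D = 2 * a * n * k + a * k ^+ 2 + (b' - b) * n + b' * k + (c' - c).
  by rewrite /D gE gE' /g; ring.
have bk1 : - (B * k) <= b' * k by rewrite -mulNr ler_pM2r //; lia.
have bk2 : b' * k <= B * k by rewrite ler_pM2r //; lia.
have D_le : D <= (a * k ^+ 2 + 2 * a * k + 4 * B + B * k) * n.
  have : a * k ^+ 2 <= a * k ^+ 2 * n by rewrite ler_peMr // ?mulr_ge0 // ?sqr_ge0; lia.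
  have : B * k <= B * k * n by rewrite ler_peMr // ?mulr_ge0 //; lia.
  by rewrite DE; lia.
have aB : 0 <= 7 * k * (a + 2 * B) * n by rewrite !mulr_ge0 //; lia.
have ank : n * k <= a * (n * k) by rewrite ler_peMl // mulr_ge0 // ltW.
have nkB : n * (16 * B) <= n * k by rewrite ler_pM2l.
have kkB : k * (16 * B) <= k ^+ 2 by rewrite expr2 ler_pM2l.
have akk : k ^+ 2 <= a * k ^+ 2 by rewrite ler_peMl // sqr_ge0.
(* [D] is nonnegative and smaller than [p], while [m < m'] gives [D >= q > p], and [m > m'] gives [D <= (q - p) * m - q < 0]. *)
case: (ltrgtP m m') => [lt_mm'|lt_m'm|eq_m].
- have : q * (m + 1) <= q * m' by rewrite ler_pM2l; lia.
  have : p * m <= q * m by rewrite ler_pM2r //; lia.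
  by rewrite /D in D_le; lia.
- have : q * m' <= q * (m - 1) by rewrite ler_pM2l; lia.
  have D_ge0 : 0 <= D by rewrite DE; lia.
  by rewrite /D in D_ge0; lia.
have DE2 : D = (q - p) * m by rewrite /D -eq_m; ring.
(* The leading terms of the two sides are [8 * a * k * n ^+ 2] and [7 * a * k * n ^+ 2]. By the
   choice of [k], the surplus is at least [16 * (B + 1) * n ^+ 2], more than the [8 * B * n ^+ 2]
   that [b' - b] can cost plus lower-order terms. *)
have nD : 4 * n * D < 7 * k * g.
  by rewrite DE2 -gE !mulrA ltr_pM2r.
have ak : 16 * (B + 1) * n ^+ 2 <= a * k * n ^+ 2.
  by rewrite -kE -mulrA ler_peMl // mulr_ge0 ?sqr_ge0 // ltW.
have kb : 7 * k * (b * n + c) <= 7 * k * (2 * (B * n)) by rewrite ler_pM2l; lia.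
have nDE : 4 * n * D = 8 * (a * k * n ^+ 2) + 4 * n * (a * k ^+ 2 + b' * k)
    + 4 * (b' * n - b * n) * n + 4 * n * (c' - c).
  by rewrite DE; ring.
have gE2 : 7 * k * g = 7 * (a * k * n ^+ 2) + 7 * k * (b * n + c) by rewrite /g; ring.
have t1 : 0 <= 4 * n * (a * k ^+ 2 + b' * k) by rewrite mulr_ge0 //; lia.
have t2 : - (4 * (2 * (B * n)) * n) <= 4 * (b' * n - b * n) * n.
  by rewrite -mulNr ler_pM2r //; lia.
have t3 : - (4 * n * (2 * B)) <= 4 * n * (c' - c) by rewrite -mulrN ler_pM2l; lia.
lia.
Qed.

(** The gap gives [q / p >= 1 + (7/4) (k/n)], and [(1 + (7/4) u)^2 >= (1 + u)^3] for
    [0 <= u <= 1/2], since [7/2 > 3]. *)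
Lemma cube_step (n k p q : int) : 0 <= k -> 2 * k <= n -> 0 <= p ->
  7 * k * p <= 4 * n * (q - p) -> p ^+ 2 * (n + k) ^+ 3 <= q ^+ 2 * n ^+ 3.
Proof.
move=> k0 kn p0 gap; have n0 : 0 <= n by lia.
have sq : (p * (4 * n + 7 * k)) ^+ 2 <= (4 * n * q) ^+ 2.
  rewrite ler_sqr ?nnegrE; first by lia.
    by rewrite mulr_ge0 //; lia.
  by have := mulr_ge0 k0 p0; lia.
have cube : 16 * (n + k) ^+ 3 <= n * (4 * n + 7 * k) ^+ 2.
  rewrite -subr_ge0.
  have -> : n * (4 * n + 7 * k) ^+ 2 - 16 * (n + k) ^+ 3 =
      k * (8 * n + k) * (n - 2 * k) + k ^+ 2 * (16 * n - 14 * k) by ring.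
  by rewrite addr_ge0 // !mulr_ge0 ?sqr_ge0 //; lia.
rewrite -(ler_pM2l (_ : 0 < 16 :> int)) //.
have := ler_wpM2l n0 sq; have := ler_wpM2l (sqr_ge0 p) cube.
rewrite !exprMn => le1 le2.
rewrite mulrCA; apply: le_trans le1 _.
have -> : p ^+ 2 * (n * (4 * n + 7 * k) ^+ 2) = n * (p ^+ 2 * (4 * n + 7 * k) ^+ 2) by ring.
by apply: le_trans le2 _; rewrite le_eqVlt; apply/orP; left; apply/eqP; ring.
Qed.

Lemma no_common_lead_quads (a : int) (B N : nat) : 1 <= a ->
  ~ (forall p : nat, prime p -> (N < p)%N -> exists b c : int,
      [/\ `|b| <= B%:Z, `|c| <= B%:Z &
      (p %| a * (primepi p)%:Z ^+ 2 + b * (primepi p)%:Z + c)%Z]).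
Proof.
move=> a1 H.
have [k kE] : exists k : nat, k = (16 * B.+1)%N by eexists.
have k_gt0 : (0 < k)%N by rewrite kE.
(* The coefficient of [n] in the lower bound that [quad_gap] requires of [p]. *)
pose K : int :=
  7 * k%:Z * (a + 2 * B%:Z) + a * k%:Z ^+ 2 + 2 * a * k%:Z + 4 * B%:Z + B%:Z * k%:Z.
have K0 : 0 <= K by rewrite /K !(addr_ge0, mulr_ge0, sqr_ge0) //; lia.
have [X1 X1P] := primepi_little_o `|K|%N.
(* Indices start at [k * J]: the term [8 * B.+1] makes [n] large enough for [quad_gap], while [N]
   and [X1] ensure [p > N] and [p >= X1] through [n <= p]. *)
have [J JE] : exists J : nat, J = (8 * B.+1 + N + X1).+1 by eexists.
(* By [cube_step], [p ^ 2 / n ^ 3] does not decrease as [n] runs through [k * J], [k * (J + 1)], and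
   so on; initially it is at least [1 / (k * J) ^ 3]. *)
have main j p : prime p -> primepi p = (k * (J + j))%N ->
    ((k * (J + j)) ^ 3 <= (k * J) ^ 3 * p ^ 2)%N.
  elim: j p => [|j IHj] q q_pr pi_q.
    by rewrite addn0 leq_pmulr // expn_gt0 prime_gt0.
  have le_Jn : (J <= k * (J + j))%N.
    by apply: leq_trans (leq_addr j J) _; rewrite leq_pmull.
  have le_Bn : (8 * k * B.+1 <= k * (J + j))%N.
    have -> : (8 * k * B.+1 = k * (8 * B.+1))%N by lia.
    by rewrite leq_mul2l; lia.
  move: IHj pi_q; rewrite addnS mulnS [(k + _)%N]addnC.
  set n := (k * (J + j))%N in le_Jn le_Bn * => IHj pi_q.
  have [p p_pr pi_p] : exists2 p, prime p & primepi p = n by apply: nth_prime_exists; lia.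
  have lt_pq : (p < q)%N.
    by rewrite ltnNge; apply/negP => /leq_primepi; rewrite pi_p pi_q; lia.
  have le_np : (n <= p)%N by rewrite -pi_p primepi_leq_id.
  have := X1P p ltac:(lia); rewrite pi_p => p_big.
  have [b [c [Bb Bc /dvdzP[m mE]]]] := H p p_pr ltac:(lia).
  have [b' [c' [Bb' Bc' /dvdzP[m' mE']]]] := H q q_pr ltac:(lia).
  have gap : 7 * k%:Z * p%:Z <= 4 * n%:Z * (q%:Z - p%:Z).
    apply: (@quad_gap a B n k p q m m' b c b' c') => //.
    - by rewrite kE PoszM -[B.+1]addn1 PoszD.
    - by move: le_Bn; clear; lia.
    - by rewrite -/K -[K]gez0_abs // -PoszM ltz_nat.
    - by rewrite mulrC -mE pi_p.
    by rewrite mulrC -mE' pi_q PoszD.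
  have step : (p ^ 2 * (n + k) ^ 3 <= q ^ 2 * n ^ 3)%N.
    have le_kn : 2 * k%:Z <= n%:Z by move: le_Bn; rewrite mulnS; clear; lia.
    by have := @cube_step n k p q isT le_kn isT gap; clear; lia.
  have n3_gt0 : (0 < n ^ 3)%N by rewrite expn_gt0 (leq_trans _ le_Jn) // JE.
  rewrite -(leq_pmul2l n3_gt0).
  apply: (@leq_trans ((k * J) ^ 3 * p ^ 2 * (n + k) ^ 3)).
    by rewrite leq_mul // IHj.
  by rewrite -mulnA [leqRHS]mulnCA leq_mul // [leqRHS]mulnC.
have [X2 X2P] := primepi_cube_lower ((k * J) ^ 3).
have n_gt0 : (0 < k * (J + X2))%N by rewrite muln_gt0 k_gt0 JE.
have [p p_pr pi_p] := nth_prime_exists n_gt0.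
have le_Xp : (X2 <= p)%N.
  apply: leq_trans (primepi_leq_id p); rewrite pi_p.
  by apply: leq_trans (leq_addl J X2) _; rewrite leq_pmull.
by have := X2P p le_Xp; rewrite pi_p ltnNge main.
Qed.

(** * Factorization and reduction to quadratic factors *)

Lemma irreducible_divisor (F : fieldType) (p : {poly F}) :
  (1 < size p)%N -> exists2 q, irreducible_poly q & q %| p.
Proof.
have [n] := ubnP (size p); elim: n p => // n IHn p le_pn p_gt1.
have p_neq0 : p != 0 by rewrite -size_poly_gt0 ltnW.
have [irr_p|red_p] := pselect (irreducible_poly p); first by exists p.
have [q [q_neq1 q_dvd q_neqp]] : exists q : {poly F}, [/\ size q != 1%N, q %| p & ~~ (q %= p)].
  apply: contrapT => no_q; apply: red_p; split=> // q q_neq1 q_dvd.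
  by apply/negPn/negP => q_neqp; apply: no_q; exists q.
have q_neq0 : q != 0 by apply: contraNneq p_neq0 => q0; rewrite q0 dvd0p in q_dvd.
have [||r irr_r r_dvd] := IHn q; last by exists r => //; apply: dvdp_trans r_dvd q_dvd.
  rewrite -(dvdp_size_eqp q_dvd) in q_neqp.
  by apply: leq_trans (_ : size p <= n)%N => //; rewrite ltn_neqAle q_neqp dvdp_leq.
by rewrite ltn_neqAle eq_sym q_neq1 size_poly_gt0.
Qed.

(** By Gauss's lemma, an irreducible rational factor is proportional to an integer polynomial
    dividing [f] over the integers, which is split off by induction on the size. Factors of size 1
    are allowed because a constant remains at the end. *)
Lemma prod_of_small_factors (d : nat) (f : {poly int}) : (0 < d)%N -> f != 0 ->
    (forall g : {poly rat}, irreducible_poly g ->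
      g %| map_poly (intr : int -> rat) f -> ((size g).-1 <= d)%N) ->
  exists2 s : seq {poly int}, f = \prod_(g <- s) g &
    all (fun g : {poly int} => 0 < size g <= d.+1)%N s.
Proof.
move=> d_gt0; have [n] := ubnP (size f); elim: n f => // n IHn f le_fn f_neq0 f_fac.
have [f_le1|f_gt1] := leqP (size f) 1.
  exists [:: f]; first by rewrite big_seq1.
  by rewrite /= size_poly_gt0 f_neq0 (leq_trans f_le1).
rewrite -size_rat_int_poly in f_gt1.
have [g irr_g g_dvd] := irreducible_divisor f_gt1.
have [h [c c_neq0 gE] [r fE]] := dvdpP_rat_int g_dvd.
have size_h : size h = size g by rewrite gE size_scale // size_rat_int_poly.
move: f_neq0; rewrite fE mulf_eq0 negb_or => /andP[h_neq0 r_neq0].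
have h_gt1 : (1 < size h)%N by rewrite size_h irr_g.1.
have [|//|q irr_q q_dvd|s rE s_small] := IHn r.
- move: le_fn; rewrite fE size_mul //; case: (size h) h_gt1 => [|[|k]] // _.
  by rewrite !addSn /= !ltnS; apply: leq_ltn_trans (leq_addl k _).
- by apply: f_fac => //; rewrite fE rmorphM dvdp_mull.
exists (h :: s); first by rewrite big_cons -rE.
rewrite /= s_small (ltnW h_gt1) size_h andbT /=.
by have := f_fac g irr_g g_dvd; case: (size g).
Qed.

Lemma Euclid_dvdz_prod (s : seq {poly int}) (p : nat) (x : int) : prime p ->
  (p %| (\prod_(g <- s) g).[x])%Z -> exists2 g : {poly int}, g \in s & (p %| g.[x])%Z.
Proof.
move=> p_pr; elim: s => [|g s IHs].
  by rewrite big_nil hornerE dvdzE /= Euclid_dvd1.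
rewrite big_cons hornerM dvdzE abszM Euclid_dvdM // => /orP[g_dvd|/IHs[h hs h_dvd]].
  by exists g; rewrite ?mem_head.
by exists h; rewrite // inE hs orbT.
Qed.

Lemma linear_ndvd_primepi (g : {poly int}) : (0 < size g <= 2)%N ->
  exists N : nat, forall p : nat, prime p -> (N < p)%N ->
    ~~ (p %| g.[(primepi p)%:Z])%Z.
Proof.
move=> /andP[g_neq0 g_le2]; rewrite size_poly_gt0 in g_neq0.
pose b := g`_0; pose a := g`_1.
have gE x : g.[x] = a * x + b.
  by rewrite (horner_coef_wide _ g_le2) !big_ord_recl big_ord0 /= expr0 expr1 mulr1 addr0 addrC.
have ab_neq0 : (a != 0) || (b != 0).
  rewrite -negb_and; apply: contraNN g_neq0 => /andP[/eqP a0 /eqP b0].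
  apply/eqP/polyP => [[|[|i]]]; rewrite coef0 // nth_default //.
  exact: leq_trans g_le2 _.
have [X XP] := primepi_little_o (`|a| + `|b|)%N.
have [Y YP] := primepi_unbounded `|b|.+1.
(* Beyond [X] the value is smaller than [p] in absolute value; beyond [Y] one has [primepi p > |b|],
   so the value is nonzero. *)
exists (X + Y)%N => p p_pr lt_Np; rewrite gE.
have pi_gt : (`|b| < primepi p)%N by apply: leq_trans YP (leq_primepi _); lia.
have pi_lt : ((`|a| + `|b|) * primepi p < p)%N by apply: XP; lia.
have val_neq0 : a * (primepi p)%:Z + b != 0.
  have [a0|a_neq0] := eqVneq a 0; first by rewrite a0 mul0r add0r; lia.
  apply/eqP => /eqP; rewrite addr_eq0 => /eqP/(congr1 absz).
  rewrite abszM abszN absz_nat.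
  have : (primepi p <= `|a| * primepi p)%N by rewrite leq_pmull // absz_gt0.
  by lia.
rewrite dvdzE /= gtnNdvd ?absz_gt0 //.
apply: leq_ltn_trans pi_lt; rewrite mulnDl.
have : (`|b| <= `|b| * primepi p)%N by rewrite leq_pmulr //; lia.
have : (absz (a * (primepi p)%:Z + b)%R <= absz (a * (primepi p)%:Z)%R + `|b|)%N by lia.
by rewrite abszM absz_nat; lia.
Qed.

(** Clearing to a common leading coefficient only multiplies each quadratic by a nonzero constant,
    so divisibility by a prime passes to the multiple. *)
Lemma common_lead_quads (s : seq {poly int}) : exists (a : int) (B : nat), 1 <= a /\
  forall g, g \in s -> size g = 3 -> exists b c : int, [/\ `|b| <= B%:Z, `|c| <= B%:Z &
    forall x, (g.[x] %| a * x ^+ 2 + b * x + c)%Z].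
Proof.
elim: s => [|h s [a [B [a1 IHs]]]]; first by exists 1, 0%N.
have [h3|h3] := eqVneq (size h) 3; last first.
  exists a, B; split=> // g; rewrite inE => /predU1P[->|]; last exact: IHs.
  by move/eqP; rewrite (negbTE h3).
pose l := h`_2.
have l_neq0 : l != 0.
  by have := lead_coef_eq0 h; rewrite -size_poly_eq0 h3 lead_coefE h3 /= => /negbT.
have l1 : 1 <= `|l| by have := normr_gt0 l; rewrite l_neq0; lia.
(* The earlier multiples are scaled by [|l|] and [h] by [a * Num.sg l], so all lead with [a * |l|].
   The sum bounds the old and the new lower coefficients at once. *)
exists (a * `|l|), (absz (B%:Z * `|l| + a * `|h`_1| + a * `|h`_0|)); split.
  by rewrite mulr_ege1.
have rhs_ge0 : 0 <= B%:Z * `|l| + a * `|h`_1| + a * `|h`_0|.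
  by rewrite !addr_ge0 // mulr_ge0 //; lia.
rewrite gez0_abs //.
have a_ge0 : 0 <= a by lia.
have Bl : 0 <= B%:Z * `|l| by rewrite mulr_ge0.
have h1_ge0 : 0 <= a * `|h`_1| by rewrite mulr_ge0.
have h0_ge0 : 0 <= a * `|h`_0| by rewrite mulr_ge0.
move=> g; rewrite inE => /predU1P[->|gs] g3; last first.
  have [b [c [Bb Bc dvd_g]]] := IHs g gs g3.
  exists (b * `|l|), (c * `|l|); rewrite !normrM normr_id; split.
  - have := ler_wpM2r (normr_ge0 l) Bb; lia.
  - have := ler_wpM2r (normr_ge0 l) Bc; lia.
  move=> x; have -> : a * `|l| * x ^+ 2 + b * `|l| * x + c * `|l| =
    (a * x ^+ 2 + b * x + c) * `|l| by ring.
  exact: dvdz_mulr.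
exists (a * Num.sg l * h`_1), (a * Num.sg l * h`_0).
rewrite !normrM normr_sg l_neq0 mulr1 (ger0_norm a_ge0); split; try lia.
move=> x; rewrite (horner_coef_wide (n := 3)) ?h3 // !big_ord_recl big_ord0 /=.
apply/dvdzP; exists (a * Num.sg l); rewrite [`|l|]normrEsg -/l.
by rewrite /bump /= expr0 expr1; ring.
Qed.

(** * From vanishing in [calA] to divisibility by almost all primes *)

Definition prodFp_eval (p : primeT) (x : prodFp) : 'F_(val p) := x p.

Fact prodFp_eval_zmod_morphism p : zmod_morphism (prodFp_eval p).
Proof. by []. Qed.
Fact prodFp_eval_monoid_morphism p : monoid_morphism (prodFp_eval p).
Proof. by []. Qed.
HB.instance Definition _ p := GRing.isZmodMorphism.Build prodFp 'F_(val p)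
  (prodFp_eval p) (prodFp_eval_zmod_morphism p).
HB.instance Definition _ p := GRing.isMonoidMorphism.Build prodFp 'F_(val p)
  (prodFp_eval p) (prodFp_eval_monoid_morphism p).

Fact toA_zmod_morphism : zmod_morphism toA.
Proof. by move=> x y; rewrite /toA rmorphB. Qed.
Fact toA_monoid_morphism : monoid_morphism toA.
Proof. by split=> [|x y]; rewrite /toA ?rmorph1 ?rmorphM. Qed.
HB.instance Definition _ := GRing.isZmodMorphism.Build prodFp calA toA toA_zmod_morphism.
HB.instance Definition _ := GRing.isMonoidMorphism.Build prodFp calA toA toA_monoid_morphism.

Lemma map_poly_intr_comp (R S : nzRingType) (phi : {rmorphism R -> S}) (f : {poly int}) :
  map_poly (intr : int -> S) f = map_poly phi (map_poly (intr : int -> R) f).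
Proof. by apply/polyP => i; rewrite !coef_map /= rmorph_int. Qed.

(** Evaluation commutes with [toA] and with each projection to ['F_p], so vanishing in [calA] means
    vanishing at all but finitely many components; [N] is the largest exceptional prime. *)
Lemma horner_primepi_A_eq0 (f : {poly int}) :
  (map_poly (intr : int -> calA) f).[primepi_A] = 0 ->
  exists N : nat, forall p : nat, prime p -> (N < p)%N -> (p %| f.[(primepi p)%:Z])%Z.
Proof.
rewrite (map_poly_intr_comp toA) horner_map -(rmorph0 toA) => /toA_eq.
set S := [set p | _]%classic => finS.
have /finite_seqP[s sE] := finite_image (fun p : primeT => val p) finS.
exists (\max_(i <- s) i)%N => p p_pr lt_sp; pose pT : primeT := exist _ p p_pr.
have : ~ S pT.
  move=> SpT; have : p \in s by suff: ([set` s] p)%classic by []; rewrite -sE; exists pT.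
  by move=> ps; move: lt_sp; rewrite ltnNge (@leq_bigmax_seq _ s xpredT id p).
move=> /negP; rewrite negbK (dvdz_pcharf (pchar_Fp p_pr)) => /eqP f0.
have evalE := horner_map (prodFp_eval pT) (map_poly intr f) (fun q => (primepi (val q))%:R).
rewrite -map_poly_intr_comp in evalE.
apply/eqP/(etrans _ f0)/(etrans _ evalE)/esym.
exact: (horner_map (intr : {rmorphism int -> 'F_p}) f (primepi p)%:Z).
Qed.

Unset Implicit Arguments.

Theorem theorem6p7 (f : {poly int}) (f_neq0 : f != 0)
  (f_factors : forall g : {poly rat}, irreducible_poly g ->
     g %| map_poly (intr : int -> rat) f -> ((size g).-1 <= 2)%N) :
  (map_poly (intr : int -> calA) f).[primepi_A] != 0.
Proof.
apply/eqP => /horner_primepi_A_eq0[N f_dvd].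
have [s fE s_small] := prod_of_small_factors (d := 2) isT f_neq0 f_factors.
have [a [B [a1 s_quad]]] := common_lead_quads s.
(* The list [s] is finite, so one threshold serves all its constant and linear factors. *)
have [M s_lin] : exists M : nat, forall g, g \in s -> (size g <= 2)%N ->
    forall p : nat, prime p -> (M < p)%N -> ~~ (p %| g.[(primepi p)%:Z])%Z.
  elim: s s_small {fE s_quad} => [|g s IHs] /=; first by exists 0%N.
  move=> /andP[/andP[g_gt0 _] /IHs[M MP]].
  have [g_le2|g_gt2] := leqP (size g) 2; last first.
    by exists M => h; rewrite inE => /predU1P[->|/MP//]; rewrite leqNgt g_gt2.
  have [L LP] : exists N : nat, forall p : nat, prime p -> (N < p)%N ->
    ~~ (p %| g.[(primepi p)%:Z])%Z by apply: linear_ndvd_primepi; rewrite g_gt0.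
  exists (maxn L M) => h; rewrite inE => /predU1P[-> _|hs h_le2] p p_pr;
    rewrite gtn_max => /andP[lt_Lp lt_Mp]; [exact: LP | exact: MP].
(* Past both thresholds, some factor is divisible by [p]; it must have size 3, and its rescaled
   multiple supplies [b] and [c]. *)
apply: (@no_common_lead_quads a B (maxn M N) a1) => p p_pr.
rewrite gtn_max => /andP[lt_Mp lt_Np].
have := f_dvd p p_pr lt_Np; rewrite fE => /(Euclid_dvdz_prod p_pr)[g gs g_dvd].
have [g_le2|g_gt2] := leqP (size g) 2.
  by have := s_lin g gs g_le2 p p_pr lt_Mp; rewrite g_dvd.
have g3 : size g = 3 by have := allP s_small g gs; lia.
have [b [c [Bb Bc dvd_g]]] := s_quad g gs g3.
by exists b, c; split=> //; apply: dvdz_trans g_dvd (dvd_g _).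
Qed.
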